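(* Let $G=G(\mathcal P,E(\mathcal P))$ be the weighted digraph of a discrete-time switched linear system, with $\mathcal P=\mathcal P_S\sqcup\mathcal P_U$, and let $\Phi:\mathbb N\to\mathbb R$ be a monotone increasing function. Suppose that $G$ is nicely connected (with respect to $\Phi$) and nicely weighted (with constants $\alpha,\beta,A,B$). Then a cycle of length at least $\lfloor\Phi(|\mathcal P_S|)\rfloor$ on $G$ obtained from the cycle-detection algorithm described in the context is contractive with probability at least $$1-\exp\left(-\frac12\left(\frac{\alpha-\beta}{A+B}\right)^2\lfloor\Phi(|\mathcal P_S|)\rfloor\right).$$ Consequently (when this cycle is contractive), the infinite walk $W$ obtained by repeating indefinitely the cycle of length at least $\lfloor\Phi(|\mathcal P_S|)\rfloor$ produced by the cycle-detection algorithm satisfies $$\limsup_{\substack{|W'|\to+\infty\\ W'\le W}}\Xi(W')<1,$$ where $W'\le W$ means that $W'$ is an initial subwalk of $W$.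
   Context: **Digraph.** $\mathcal P=\{1,\dots,N\}$ is a finite set of vertices (indices of linear subsystems), partitioned as $\mathcal P=\mathcal P_S\sqcup\mathcal P_U$ (stable and unstable subsystems). $E(\mathcal P)\subseteq\mathcal P\times\mathcal P$ is the set of directed edges (admissible transitions; self-loops allowed). Each vertex $j$ has a weight $w(j)$ and each edge $(i,j)$ a weight $w(i,j)$; here the weights are random variables. For $j\in\mathcal P$, $N^+_{\mathcal P_S}(j)=\{u\in\mathcal P_S : (j,u)\in E(\mathcal P)\}$ and $d^+_{\mathcal P_S}(j)=|N^+_{\mathcal P_S}(j)|$. **Nicely connected.** $d^+_{\mathcal P_S}(j)\ge\lfloor\Phi(|\mathcal P_S|)\rfloor$ for all $j\in\mathcal P$. **Nicely weighted.** (1) There exist $0<\beta<B$ such that the vertex weights $w(j)$ are independent and $0<w(j)\le B$ with $\mathbb E[w(j)]=\beta$ for all $j\in\mathcal P$. (2) There exist constants $A>0$ and $\alpha<\beta$ such that for every $(i,j)\in E(\mathcal P)$, $w(i,j)\in[-A,A]$ and $\mathbb E[w(i,j)]\le\alpha$. **Cycle-detection algorithm.** Step 1: set $k=0$ and pick $j_0\in\mathcal P_S$ uniformly at random. Step 2: if $N^+_{\mathcal P_S}(j_k)\setminus\{j_0,\dots,j_k\}\ne\emptyset$, pick $j_{k+1}$ uniformly at random from this set, replace $k$ by $k+1$, and repeat Step 2; otherwise pick $j_{k+1}=j_i$ such that $j_i\in N^+_{\mathcal P_S}(j_k)$ and $k-i$ is maximum, and stop. The cycle obtained is $j_i,(j_i,j_{i+1}),j_{i+1},\dots,j_k,(j_k,j_i),j_i$.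 The algorithm uses only $\mathcal P_S$ and the edges, not the weights. **Walks.** A walk is an alternating sequence $x_0,e_1,x_1,\dots,e_\ell,x_\ell$ of vertices and edges with $e_i=(x_{i-1},x_i)\in E(\mathcal P)$, of length $\ell$. It is closed if $x_0=x_\ell$. A cycle is a closed walk in which the vertices $x_i$, $0<i<\ell$, are distinct from each other and from $x_0$. An initial subwalk is an initial segment. **The function $\Xi$ and contractivity.** For a finite walk $W$, with $\sharp\{k\to\ell\}_W$ and $\sharp\{j\}_W$ the number of times the edge $(k,\ell)$ and the vertex $j$ appear in $W$, $$\Xi(W)=\frac{\sum_{(k,\ell)\in E(\mathcal P)}w(k,\ell)\,\sharp\{k\to\ell\}_W+\sum_{j\in\mathcal P_U}w(j)\,\sharp\{j\}_W}{\sum_{j\in\mathcal P_S}w(j)\,\sharp\{j\}_W}.$$ A walk is contractive if $\Xi(W)<1$. For a closed walk, $\sharp\{j\}_W$ is by convention $\sum_{(j,\ell)\in E(\mathcal P)}\sharp\{j\to\ell\}_W$, so that contractivity means $$\sum_{(k,\ell)\in E(\mathcal P)}\bigl(w(k,\ell)+w(k)1_{\mathcal P_U}(k)-w(k)1_{\mathcal P_S}(k)\bigr)\,\sharp\{k\to\ell\}_W<0.$$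
   Formalization: Independence is added: over the vertices j, the families formed by w(j) and the weights w(j,l) of the edges leaving j are mutually independent; with only the vertex weights independent the probability bound is false (e.g. all edge weights equal to one random sign). *)

(* Defs.v *)
From HB Require Import structures.
From mathcomp Require Import all_boot all_order all_algebra.
From mathcomp Require Import all_classical all_reals all_analysis.

Set Implicit Arguments.
Unset Strict Implicit.
Unset Printing Implicit Defensive.

Import Order.TTheory GRing.Theory Num.Theory.
Import numFieldNormedType.Exports.

Local Open Scope classical_set_scope.
Local Open Scope ring_scope.

(* A walk x_0, e_1, x_1, ..., e_l, x_l is encoded by its vertex sequence
   [:: x_0; ...; x_l]: an edge is an ordered pair, so e_i is (x_{i-1}, x_i).
   The empty sequence is not a walk. *)

Section Walks.
Variables (V : finType) (e : rel V).

Definition is_walk (W : seq V) : bool :=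
  if W is x :: p then path e x p else false.

Definition walk_length (W : seq V) : nat := (size W).-1.

Definition is_closed (W : seq V) : bool :=
  if W is x :: p then last x p == x else false.

(* When x_l = x_0 and l > 0, the distinctness of the x_i, 0 < i < l, from each
   other and from x_0 is the distinctness of x_1, ..., x_l. *)
Definition is_cycle (W : seq V) : bool :=
  [&& is_walk W, is_closed W, (0 < walk_length W)%N & uniq (behead W)].

Definition edge_count (k l : V) (W : seq V) : nat :=
  count_mem (k, l) (zip W (behead W)).

(* In a closed walk the common endpoint is counted once only. *)
Definition vertex_count (j : V) (W : seq V) : nat :=
  if is_closed W then (\sum_(l | e j l) edge_count j l W)%N
  else count_mem j W.

Definition Xi (R : realType) (PS PU : {set V}) (wv : V -> R) (we : V -> V -> R)
    (W : seq V) : R :=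
  (\sum_k \sum_(l | e k l) we k l * (edge_count k l W)%:R
    + \sum_(j in PU) wv j * (vertex_count j W)%:R)
  / (\sum_(j in PS) wv j * (vertex_count j W)%:R).

Definition contractive (R : realType) (PS PU : {set V}) (wv : V -> R)
    (we : V -> V -> R) (W : seq V) : Prop :=
  Xi PS PU wv we W < 1.

End Walks.

Section InfiniteWalks.
Variable V : Type.

(* Vertices of the infinite walk that repeats the closed walk x :: p, whose
   length is size p. *)
Definition repeat_walk (x : V) (p : seq V) (m : nat) : V :=
  nth x (x :: p) (m %% size p).

Definition initial_subwalk (W : nat -> V) (n : nat) : seq V := mkseq W n.+1.

End InfiniteWalks.

Section CycleDetection.
Variables (V : finType) (e : rel V) (PS : {set V}).

Definition stable_out (j : V) : {set V} := [set u in PS | e j u]%SET.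

Definition fresh (visited : seq V) (j : V) : {set V} :=
  (stable_out j :\: [set x in visited])%SET.

Variable R : realType.

(* Probability that, being at j after having visited the vertices in visited,
   the algorithm visits successively the vertices of s and then leaves the loop
   of Step 2. *)
Fixpoint continue_prob (visited : seq V) (j : V) (s : seq V) : R :=
  if s is j' :: s' then
    if j' \in fresh visited j then
      #|fresh visited j|%:R^-1 * continue_prob (j' :: visited) j' s'
    else 0
  else (fresh visited j == finset.set0)%:R.

(* Probability that the vertices visited by the algorithm are exactly
   j_0, ..., j_k, in this order. *)
Definition run_prob (s : seq V) : R :=
  if s is j0 :: s' then
    if j0 \in PS then #|PS|%:R^-1 * continue_prob [:: j0] j0 s' else 0
  else 0.

(* The closed walk j_i, j_{i+1}, ..., j_k, j_i, where i is the least index such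
   that j_i is in stable_out j_k, that is, the one for which k - i is maximum.
   If there is no such index, no cycle is detected and the value is [::]. *)
Definition detected_cycle (s : seq V) : seq V :=
  if s is j0 :: s' then
    let c := drop (find (mem (stable_out (last j0 s'))) s) s in
    if c is x :: p then x :: rcons p x else [::]
  else [::].

End CycleDetection.

Definition nicely_connected (R : realType) (V : finType) (e : rel V)
    (PS : {set V}) (Phi : nat -> R) : Prop :=
  forall j : V, Num.floor (Phi #|PS|) <= (#|stable_out e PS j|)%:Z.

Section Probability.
Context d (T : measurableType d) (R : realType) (P : probability T R).

Definition mutually_independent (I : finType) (F : I -> set (set T)) : Prop :=
  forall (D : {set I}) (E : I -> set T), (forall i, i \in D -> F i (E i)) ->
    P (\bigcap_(i in [set` D]) E i) = (\prod_(i in D) P (E i))%E.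

(* The sigma-algebra generated by a set of real random variables. *)
Definition sigma_rv (Xs : set (T -> R)) : set (set T) :=
  <<s [set X @^-1` B | X in Xs & B in [set B : set R | measurable B]] >>.

Variables (V : finType) (e : rel V).
Variables (wv : V -> {RV P >-> R}) (we : V -> V -> {RV P >-> R}).

Definition nicely_weighted (alpha beta A B : R) : Prop :=
  [/\ 0 < beta < B,
      mutually_independent (fun j => sigma_rv [set (wv j : T -> R)]),
      forall j, (forall t, 0 < wv j t <= B) /\ ('E_P[wv j] = beta%:E)%E,
      0 < A /\ alpha < beta &
      forall i j, e i j ->
        (forall t, - A <= we i j t <= A) /\ ('E_P[we i j] <= alpha%:E)%E].

(* The weight of j together with the weights of the edges leaving j. *)
Definition out_weights (j : V) : set (T -> R) :=
  [set X : T -> R | X = wv j \/ exists2 l, e j l & X = we j l].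

(* No relation is imposed between the weights attached to one and the same
   source vertex. *)
Definition independent_sources : Prop :=
  mutually_independent (fun j => sigma_rv (out_weights j)).

(* J is the random sequence j_0, ..., j_k of vertices visited by the algorithm;
   its random choices do not depend on the weights. *)
Definition algorithm_run (PS : {set V}) (J : T -> seq V) : Prop :=
  [/\ forall s, measurable (J @^-1` [set s]),
      forall s, P (J @^-1` [set s]) = (run_prob e PS R s)%:E &
      forall (S : set (seq V)) (E : set T),
        sigma_rv (\bigcup_j out_weights j) E ->
        P (J @^-1` S `&` E) = (P (J @^-1` S) * P E)%E].

End Probability.

(* Main.v *)
(* The algorithm stops at a vertex all of whose stable out-neighbours have been
   visited, and the detected cycle contains all of them: its length m is at least
   L. Conditionally on the visited sequence, which is independent of the weights,
   the cycle is contractive iff the sum of X_j = w(j, next j) - w(j) over its m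
   vertices is negative. The X_j are independent, lie in [-c, c] with c = A + B,
   and have mean at most -delta, where delta = beta - alpha. With u = delta / c,
   convexity of exp bounds E[exp(u X_j / c)] by cosh u - u sinh u <= 1 - u^2 / 2
   <= exp(- u^2 / 2), and Markov's inequality applied to the product over j gives
   P(sum >= 0) <= exp(- m u^2 / 2).
   Along the repeated cycle numerator and denominator of Xi grow linearly, with
   slopes given by one period, up to bounded terms. *)
Require Import Defs.
From mathcomp Require Import all_boot all_order all_algebra.
From mathcomp Require Import all_classical all_reals all_analysis.
From mathcomp Require Import measurable_realfun ring lra zify.
Import Order.TTheory GRing.Theory Num.Theory.
Import numFieldNormedType.Exports.
Local Open Scope classical_set_scope.
Local Open Scope ring_scope.

Set Implicit Arguments.
Unset Strict Implicit.
Unset Printing Implicit Defensive.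

(** * Expectation of a product of independent nonnegative variables *)

Section Independence.
Context d (T : measurableType d) (R : realType).

Import HBNNSimple.

Local Open Scope ereal_scope.

(** The assumption on the events of [F] passes by linearity to simple functions of [f], and by
    monotone convergence to [f] itself. *)
Lemma integral_mul_indep (mu : {measure set T -> \bar R}) (F : set (set T))
    (h f : T -> R) (c : R) :
  (forall t, 0 <= h t)%R -> measurable_fun setT h ->
  (forall t, 0 <= f t)%R -> measurable_fun setT f ->
  (forall B, measurable B -> F (f @^-1` B)) ->
  (forall E, F E -> \int[mu]_t (h t * \1_E t)%:E = c%:E * mu E) ->
  \int[mu]_t (h t * f t)%:E = c%:E * \int[mu]_t (f t)%:E.
Proof.
move=> h0 mh f0 mf Ff hE.
have simple (phi : {nnsfun R >-> R}) :
    \int[mu]_t (h t * phi (f t))%:E = c%:E * \int[mu]_t (phi (f t))%:E.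
  pose S := finmap.enum_fset (fset_set (range phi)); pose E y := f @^-1` (phi @^-1` [set y]).
  (* The values of [phi] are nonnegative, so the absolute value changes nothing; it makes the
     coefficient nonnegative for every real y. *)
  have phiE t : phi (f t) = (\sum_(y <- S) (`|y| * \1_(E y) t))%R.
    rewrite (fimfunE phi) fsbig_finite//=; apply: eq_bigr => y _.
    change (\1_(phi @^-1` [set y]) (f t)) with (\1_(E y) t : R).
    rewrite indicE; have [/set_mem /= <-|_] := boolP (_ \in _).
      by rewrite ger0_norm.
    by rewrite /= !mulr0.
  have mE y : measurable (E y) by rewrite -[E y]setTI; exact: mf.
  have m1E y : measurable_fun setT (\1_(E y) : T -> R).
    exact: measurable_indic.
  under eq_integral do rewrite phiE mulr_sumr -sumEFin.
  under [in RHS]eq_integral do rewrite phiE -sumEFin.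
  rewrite !ge0_integral_sum//; last 3 first.
  - by move=> y; apply/measurable_EFinP; exact: measurable_funM.
  - move=> y; apply/measurable_EFinP; apply: measurable_funM => //.
    exact: measurable_funM.
  - by move=> y t _; rewrite lee_fin !mulr_ge0.
  rewrite ge0_sume_distrr; last first.
    by move=> y _; apply: integral_ge0 => t _; rewrite lee_fin mulr_ge0.
  apply: eq_bigr => y _.
  under eq_integral do rewrite mulrCA EFinM.
  under [in RHS]eq_integral do rewrite EFinM.
  rewrite !ge0_integralZl_EFin//; last 3 first.
  - exact/measurable_EFinP.
  - by move=> t _; rewrite lee_fin mulr_ge0.
  - by apply/measurable_EFinP; exact: measurable_funM.
  rewrite hE; last by apply: Ff; rewrite -[_ @^-1` _]setTI; exact: measurable_funP.
  by rewrite integral_indic// setIT muleCA.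
(* The positive part is approximated on the real line and then composed with [f], so that the level
   sets are preimages under [f] and lie in [F]. *)
have mg : measurable_fun setT (fun x : R => (Num.max x 0)%:E).
  by apply/measurable_EFinP; apply: measurable_maxr.
pose phi := nnsfun_approx measurableT mg.
have phi_cvg t : (phi n (f t))%:E @[n --> \oo] --> (f t)%:E.
  have -> : (f t)%:E = (Num.max (f t) 0)%:E by rewrite max_l.
  apply: (cvg_nnsfun_approx measurableT mg _ Logic.I) => x _.
  by rewrite lee_fin le_max lexx orbT.
have mphi n : measurable_fun setT (fun t => phi n (f t)).
  by apply: measurableT_comp => //; exact: measurable_funP.
have phi_nd t : {homo (fun n => phi n (f t)) : n m / (n <= m)%N >-> (n <= m)%R}.
  by move=> n m nm; exact/lefP/nd_nnsfun_approx.
have lhs : \int[mu]_t (h t * phi n (f t))%:E @[n --> \oo]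
    --> \int[mu]_t (h t * f t)%:E.
  rewrite (_ : (fun t => (h t * f t)%:E) =
    fun t => limn (fun n => (h t * phi n (f t))%:E)); last first.
    apply/funext => t; apply/esym/cvg_lim => //.
    under eq_fun do rewrite EFinM.
    by rewrite EFinM; apply: cvgeZl.
  apply: cvg_monotone_convergence => //.
  - by move=> n; apply/measurable_EFinP; exact: measurable_funM.
  - by move=> n t _; rewrite lee_fin mulr_ge0.
  - by move=> t _ n m nm; rewrite lee_fin ler_wpM2l// phi_nd.
have rhs : \int[mu]_t (phi n (f t))%:E @[n --> \oo] --> \int[mu]_t (f t)%:E.
  rewrite (_ : (fun t => (f t)%:E) = fun t => limn (fun n => (phi n (f t))%:E)).
    apply: cvg_monotone_convergence => //.
    - by move=> n; exact/measurable_EFinP.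
    - by move=> n t _; rewrite lee_fin.
    - by move=> t _ n m nm; rewrite lee_fin phi_nd.
  by apply/funext => t; exact/esym/cvg_lim.
move: lhs; rewrite (_ : (fun n => \int[mu]_t (h t * phi n (f t))%:E) =
  fun n => c%:E * \int[mu]_t (phi n (f t))%:E).
  by move=> lhs; apply: (cvg_unique (@ereal_hausdorff R) lhs); exact: cvgeZl.
by apply/funext => n; exact: simple.
Qed.

Section ExpectationProd.
Context (P : probability T R) (I : finType) (F : I -> set (set T)).
Hypotheses (indepF : mutually_independent P F)
  (measF : forall i E, F i E -> measurable E).
Context (K : eqType) (g : K -> I) (f : K -> T -> R) (m : K -> R).
Hypotheses (f0 : forall k t, (0 <= f k t)%R)
  (Ff : forall k B, measurable B -> F (g k) (f k @^-1` B))
  (intf : forall k, \int[P]_t (f k t)%:E = (m k)%:E).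

(* Carrying the indicator of an intersection of events makes the induction on
   [r] go through: the independence hypothesis only speaks about events. *)
Let integral_prod_indic (r : seq K) : uniq (map g r) ->
  forall (D : {set I}) (E : I -> set T), (forall i, i \in D -> F i (E i)) ->
  {in r, forall k, g k \notin D} ->
  \int[P]_t ((\prod_(k <- r) f k t) * \1_(\bigcap_(i in [set` D]) E i) t)%:E =
  (\prod_(k <- r) m k)%:E * P (\bigcap_(i in [set` D]) E i).
Proof.
have mf k : measurable_fun setT (f k).
  by move=> _ B mB; rewrite setTI; apply: measF; exact: Ff.
have mbig (D : {set I}) (E : I -> set T) : (forall i, i \in D -> F i (E i)) ->
    measurable (\bigcap_(i in [set` D]) E i).
  move=> FE; apply: fin_bigcap_measurable => // i /= iD.
  exact/measF/FE.
elim: r => [_|k r IH /= /andP[gkr ur]] D E FE rD.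
  rewrite big_nil mul1e; under eq_integral do rewrite big_nil mul1r.
  by rewrite integral_indic ?setIT//; exact: mbig.
have gkD : g k \notin D by apply: rD; rewrite mem_head.
have mI : measurable (\bigcap_(i in [set` D]) E i) by exact: mbig.
pose h t := ((\prod_(k <- r) f k t) * \1_(\bigcap_(i in [set` D]) E i) t)%R.
pose c := ((\prod_(k <- r) m k) * fine (P (\bigcap_(i in [set` D]) E i)))%R.
have -> : (\prod_(k <- k :: r) m k)%:E * P (\bigcap_(i in [set` D]) E i) =
    c%:E * \int[P]_t (f k t)%:E.
  rewrite big_cons intf /c !EFinM fineK ?fin_num_measure//.
  by rewrite -muleA muleC.
rewrite -(@integral_mul_indep P (F (g k)) h (f k) c)//.
- by apply: eq_integral => t _; rewrite big_cons -mulrA mulrC.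
- by move=> t; rewrite mulr_ge0// prodr_ge0.
- apply: measurable_funM; first exact: measurable_prod.
  exact: measurable_indic.
- exact: Ff.
move=> A FA.
(* Multiplying by the indicator of [A] amounts to adding the index [g k] to [D] with event [A]; the
   induction hypothesis covers this larger family. *)
pose E' i := if i == g k then A else E i.
have FE' i : i \in (g k |: D)%SET -> F i (E' i).
  by rewrite finset.in_setU1 /E'; case: eqP => [-> _|_ /= /FE].
have E'E i : i \in D -> E' i = E i.
  by rewrite /E'; case: eqP => // -> gD; rewrite gD in gkD.
have E'I : \bigcap_(i in [set` (g k |: D)%SET]) E' i =
    \bigcap_(i in [set` D]) E i `&` A.
  apply/seteqP; split => [t Et|t [Et At] i /=].
    split=> [i /= iD|]; last first.
      by have := Et (g k); rewrite /= /E' eqxx; apply; exact: setU11.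
    by rewrite -E'E//; apply: Et => /=; exact: setU1r.
  by rewrite finset.in_setU1 => /predU1P[->|iD]; [rewrite /E' eqxx|rewrite E'E//; exact: Et].
have := IH ur (g k |: D)%SET E' FE'; rewrite E'I.
have -> : \int[P]_t ((\prod_(k <- r) f k t) *
      \1_(\bigcap_(i in [set` D]) E i `&` A) t)%:E =
    \int[P]_t (h t * \1_A t)%:E.
  by apply: eq_integral => t _; rewrite indicI /h mulrA.
move=> ->; last first.
  move=> j jr; rewrite finset.in_setU1 negb_or rD ?andbT; last by rewrite inE jr orbT.
  by apply: contra gkr => /eqP <-; exact: map_f.
rewrite -E'I indepF// big_setU1//= {1}/E' eqxx.
rewrite (eq_bigr (fun i => P (E i))); last by move=> i iD; rewrite E'E.
by rewrite -indepF// /c EFinM fineK ?fin_num_measure// muleA muleAC.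
Qed.

Lemma integral_prod_indep (r : seq K) : uniq (map g r) ->
  \int[P]_t (\prod_(k <- r) f k t)%:E = (\prod_(k <- r) m k)%:E.
Proof.
move=> ur.
have := @integral_prod_indic r ur finset.set0 (fun=> setT).
rewrite (_ : [set` finset.set0] = set0); last first.
  by apply/seteqP; split => // i /=; rewrite inE.
rewrite bigcap_set0 probability_setT mule1 => <- //.
- by apply: eq_integral => t _; rewrite indicT mulr1.
- by move=> i; rewrite inE.
- by move=> k _; rewrite inE.
Qed.

End ExpectationProd.

End Independence.

(** * Two inequalities for the exponential *)

Section ExpBounds.
Variable R : realType.

(** Convexity: y * x is the mean of - y and y with weights (1 - x) / 2 and (1 + x) / 2. *)
Lemma expR_le_chord (y x : R) : -1 <= x <= 1 ->
  expR (y * x) <= ((1 - x) * expR (- y) + (1 + x) * expR y) / 2.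
Proof.
move=> /andP[x1 x2].
have t0 : 0 <= (1 - x) / 2 by lra.
have t1 : (1 - x) / 2 <= 1 by lra.
have := @convex_expR R (Itv01 t0 t1) (- y : R^o) (y : R^o).
rewrite !convRE /= /unstable.onem.
have -> : (1 - x) / 2 * - y + (1 - (1 - x) / 2) * y = y * x by field.
by move=> /le_trans; apply; lra.
Qed.

(* The Taylor coefficients of the left-hand side are [(1 - 2k) / (2k)!]. *)
Lemma cosh_sub_sinh_le (u : R) : 0 <= u ->
  ((1 + u) * expR (- u) + (1 - u) * expR u) / 2 <= 1 - u ^+ 2 / 2.
Proof.
move=> u0.
pose f (x : R) : R :=
  1 - x ^+ 2 / 2 - ((1 + x) * expR (- x) + (1 - x) * expR x) / 2.
(* The derivative of [f] is x * (cosh x - 1), nonnegative for x >= 0, and [f] vanishes at 0. *)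
pose df (x : R) := x * ((expR x + expR (- x)) / 2 - 1).
have fE (x : R) : is_derive x 1 f (df x).
  rewrite /f /df; apply: is_derive_eq; by rewrite /GRing.scale /=; field.
have fc : {within `[0, u], continuous f}.
  apply: continuous_subspaceT => z.
  exact/differentiable_continuous/derivable1_diffP/ex_derive.
have [c] := MVT_segment u0 (fun x _ => fE x) fc.
rewrite in_itv /= => /andP[c0 _].
have -> : f 0 = 0 by rewrite /f oppr0 expR0; field.
have : 0 <= df c * (u - 0).
  rewrite subr0 mulr_ge0// mulr_ge0//.
  by have := expR_ge1Dx c; have := expR_ge1Dx (- c); lra.
rewrite subr0 => df0 fu; rewrite -fu /f in df0; lra.
Qed.

End ExpBounds.

(** * A Hoeffding-type tail bound *)

Section Hoeffding.
Context d (T : measurableType d) (R : realType) (P : probability T R).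

Lemma integrable_bounded (X : T -> R) (c : R) :
  measurable_fun setT X -> (forall t, `|X t| <= c) ->
  P.-integrable setT (EFin \o X).
Proof.
move=> mX Xc; apply: measurable_bounded_integrable => //.
  by rewrite ltey_eq fin_num_measure.
exists c; split; first exact: num_real.
by move=> M /ltW cM t _; exact: le_trans (Xc t) cM.
Qed.

(** [g] gives the independence class of each summand. Exponentials are replaced by chords lying
    above them, whose product still dominates the indicator of the event. *)
Lemma prob_sum_ge0_le (I : finType) (F : I -> set (set T)) (K : eqType)
    (g : K -> I) (X : K -> T -> R) (m : K -> R) (c delta : R) (r : seq K) :
  mutually_independent P F -> (forall i E, F i E -> measurable E) ->
  0 < c -> 0 <= delta ->
  (forall k B, measurable B -> F (g k) (X k @^-1` B)) ->
  (forall k t, `|X k t| <= c) ->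
  (forall k, (\int[P]_t (X k t)%:E = (m k)%:E)%E) ->
  (forall k, m k <= - delta) ->
  uniq (map g r) ->
  (P [set t | (0 <= \sum_(k <- r) X k t)%R]
    <= (expR (- (2^-1 * (delta / c) ^+ 2 * (size r)%:R)))%:E)%E.
Proof.
move=> indep measF c0 d0 FX Xc intX md ur.
pose u := delta / c.
(* [a] is cosh u and [b] is sinh u / c. *)
pose a := (expR u + expR (- u)) / 2.
pose b := (expR u - expR (- u)) / (2 * c).
have u0 : 0 <= u by rewrite divr_ge0// ltW.
have b0 : 0 <= b.
  rewrite divr_ge0//; last by rewrite mulr_ge0// ltW.
  by rewrite subr_ge0 ler_expR; lra.
have mX k : measurable_fun setT (X k).
  by move=> _ B mB; rewrite setTI; apply: measF; exact: FX.
(* [f k] is the chord of [fun x => expR (u * x / c)] over [-c, c], taken at [X k];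
   being affine, it has an expectation determined by that of [X k]. *)
pose f k t := a + b * X k t.
have fE k t : f k t =
    ((1 - X k t / c) * expR (- u) + (1 + X k t / c) * expR u) / 2.
  by rewrite /f /a /b; field; exact: lt0r_neq0.
have fX k t : expR (u * (X k t / c)) <= f k t.
  rewrite fE; apply: expR_le_chord.
  by rewrite -ler_norml normrM normfV (gtr0_norm c0) ler_pdivrMr// mul1r.
have f0 k t : 0 <= f k t by apply: le_trans (fX k t); exact: expR_ge0.
have mf k : measurable_fun setT (f k).
  by apply: measurable_funD => //; exact: measurable_funM.
have Ff k B : measurable B -> F (g k) (f k @^-1` B).
  move=> mB; have -> : f k @^-1` B = X k @^-1` ((fun x => a + b * x) @^-1` B).
    by [].
  apply: FX; rewrite -[_ @^-1` _]setTI.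
  have : measurable_fun setT (fun x : R => a + b * x).
    by apply: measurable_funD => //; exact: measurable_funM.
  exact.
have intf k : (\int[P]_t (f k t)%:E = (a + b * m k)%:E)%E.
  have iX := integrable_bounded (mX k) (Xc k).
  have -> : (\int[P]_t (f k t)%:E = \int[P]_t (a%:E + b%:E * (X k t)%:E))%E.
    by [].
  rewrite integralD//; last 2 first.
  - exact: finite_measure_integrable_cst.
  - exact: integrableZl.
  rewrite integral_cst// integralZl// intX EFinD EFinM.
  by congr (_ + _)%E; rewrite -[RHS]mule1; congr (_ * _)%E; exact: probability_setT.
(* As b >= 0, the worst mean is - delta, where the chord takes the value cosh u - u * sinh u. *)
have fm k : a + b * m k <= expR (- (u ^+ 2 / 2)).
  apply: (@le_trans _ _ (a - b * delta)).
    by rewrite lerD2l -mulrN ler_wpM2l.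
  have -> : a - b * delta = ((1 + u) * expR (- u) + (1 - u) * expR u) / 2.
    by rewrite /a /b /u; field; exact: lt0r_neq0.
  apply: le_trans (cosh_sub_sinh_le u0) _.
  exact: expR_ge1Dx.
set S := [set t | _]; have mS : measurable S.
  rewrite -[X in measurable X]setTI.
  have -> : S =
      (fun t => \sum_(k <- r) X k t) @^-1` `[0, +oo[.
    by apply/seteqP; split => t /=; rewrite in_itv /= andbT.
  have mX' : measurable_fun setT (fun t => \sum_(k <- r) X k t).
    exact: measurable_sum.
  exact: (mX' measurableT _ (measurable_itv _)).
apply: (@le_trans _ _ (\int[P]_t (\prod_(k <- r) f k t)%:E)%E).
  rewrite -(setIT S) -integral_indic//.
  apply: ge0_le_integral => //.
  - by apply/measurable_EFinP; exact: measurable_indic.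
  - by apply/measurable_EFinP; exact: measurable_prod.
  move=> t _; rewrite lee_fin indicE.
  have [/set_mem /= St|_] := boolP (t \in _); last exact: prodr_ge0.
  apply: (@le_trans _ _ (expR (\sum_(k <- r) u * (X k t / c)))).
    rewrite -mulr_sumr -mulr_suml -[leLHS]expR0 ler_expR.
    by rewrite mulr_ge0// divr_ge0// ltW.
  rewrite expR_sum; apply: ler_prod => k _.
  by rewrite expR_ge0 fX.
rewrite (@integral_prod_indep _ _ _ P I F _ _ K g f (fun k => a + b * m k))//.
rewrite lee_fin.
apply: (@le_trans _ _ (\prod_(k <- r) expR (- (u ^+ 2 / 2)))).
  apply: ler_prod => k _; rewrite fm andbT -lee_fin -intf.
  by apply: integral_ge0 => t _; rewrite lee_fin.
rewrite -expR_sum big_const_seq count_predT iter_addr_0 ler_expR.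
by rewrite -mulr_natr -/u; lra.
Qed.

End Hoeffding.

(** * Runs of the algorithm and the cycle they detect *)

Section DetectedCycle.
Variables (V : finType) (e : rel V) (PS : {set V}).

Variable R : realType.

(** A nonzero product has only nonzero factors, so each step picks a fresh vertex. Visited vertices
    are added at the head, whence [rev s]. *)
Lemma continue_prob_neq0 (visited : seq V) (j : V) (s : seq V) :
  continue_prob e PS R visited j s != 0 ->
  [/\ path e j s, all (mem PS) s, uniq s, ~~ has (mem visited) s &
      fresh e PS (rev s ++ visited) (last j s) = finset.set0].
Proof.
elim: s visited j => [|j' s IH] visited j /=.
  by rewrite pnatr_eq0 eqb0 negbK => /eqP.
case: ifP => [|_]; last by rewrite eqxx.
rewrite /fresh !inE => /and3P[j'v j'S ej'].
rewrite mulf_eq0 negb_or => /andP[_ /IH[pa al un nh fr]].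
split => //.
- by rewrite ej' pa.
- by rewrite /= j'S.
- rewrite un andbT; apply: contra nh => j's.
  by apply/hasP; exists j' => //=; rewrite inE eqxx.
- rewrite negb_or j'v /=; apply: contra nh => /hasP[y ys /= yv].
  by apply/hasP; exists y => //=; rewrite inE yv orbT.
- by rewrite rev_cons cat_rcons.
Qed.

Lemma run_prob_neq0 (j : V) (s : seq V) : run_prob e PS R (j :: s) != 0 ->
  [/\ path e j s, all (mem PS) (j :: s), uniq (j :: s) &
      {subset stable_out e PS (last j s) <= j :: s}].
Proof.
rewrite /run_prob; case: ifP => [jS|_]; last by rewrite eqxx.
rewrite mulf_eq0 negb_or => /andP[_ /continue_prob_neq0[pa al un nh fr]].
split => //; first by rewrite /= jS.
  rewrite /= un andbT; apply: contra nh => js.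
  by apply/hasP; exists j => //=; rewrite inE.
move=> y yl; apply/negPn/negP => yjs.
have : y \in fresh e PS (rev s ++ [:: j]) (last j s).
  rewrite /fresh finset.in_setD yl andbT inE mem_cat mem_rev inE orbC.
  by rewrite -in_cons.
by rewrite fr inE.
Qed.

(** The cycle starts at the first visited stable out-neighbour of the last vertex, so it contains
    all these neighbours, and they are distinct. *)
Lemma detected_cycle_run (j : V) (s : seq V) :
  run_prob e PS R (j :: s) != 0 -> stable_out e PS (last j s) != finset.set0 ->
  let C := detected_cycle e PS (j :: s) in
  [/\ is_cycle e C, all (mem PS) C &
      (#|stable_out e PS (last j s)| <= walk_length C)%N].
Proof.
move=> /run_prob_neq0[pa al un sub] /finset.set0Pn[z zl] C.
pose a := mem (stable_out e PS (last j s)).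
have ha : has a (j :: s) by apply/hasP; exists z => //; exact: sub.
pose q := take (find a (j :: s)) (j :: s).
pose x := nth j (j :: s) (find a (j :: s)).
pose p := drop (find a (j :: s)).+1 (j :: s).
have ax : a x by exact: nth_find.
have dE : drop (find a (j :: s)) (j :: s) = x :: p.
  by rewrite (drop_nth j)// -has_find.
have sE : j :: s = q ++ x :: p by rewrite -dE cat_take_drop.
have CE : C = x :: rcons p x by rewrite /C /detected_cycle dE.
have lE : last j s = last x p.
  by rewrite -[LHS]/(last j (j :: s)) sE last_cat.
have exl : e (last x p) x by move: ax; rewrite /a /= inE lE => /andP[].
have xpu : uniq (x :: p) by move: un; rewrite sE cat_uniq => /and3P[].
have xpS : all (mem PS) (x :: p) by move: al; rewrite sE all_cat => /andP[].
have pxp : path e x p.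
  have := pa; rewrite -[path e j s]/(sorted e (j :: s)) sE.
  by move=> /cat_sorted2[].
split; rewrite CE.
- rewrite /is_cycle /walk_length /= rcons_path pxp exl last_rcons eqxx
    size_rcons rcons_uniq; exact: xpu.
- by rewrite -rcons_cons all_rcons xpS andbT; case/andP: xpS.
rewrite /walk_length /= size_rcons -[(size p).+1]/(size (x :: p)).
rewrite cardE; apply: uniq_leq_size; first exact: enum_uniq.
move=> y; rewrite mem_enum => yl.
have ya : a y by [].
(* A neighbour off the cycle would lie in the prefix [q], before the first index found. *)
rewrite -dE; apply: contraT => ynd.
have /(nthP j)[i ilt yE] : y \in q.
  by have := sub y yl; rewrite sE mem_cat => /orP[//|]; rewrite -dE (negPf ynd).
move: ilt; rewrite size_take -has_find ha => ilt.
have := before_find j ilt; rewrite -(nth_take _ ilt) -/q yE ya.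
by [].
Qed.

End DetectedCycle.

(** * Weighted counts along a walk as sums over time *)

Section WalkSums.
Variables (V : finType) (e : rel V) (R : realType).

Lemma edge_count_mkseq (w : nat -> V) (n : nat) (k l : V) :
  edge_count k l (mkseq w n.+1) = (\sum_(i < n) ((w i, w i.+1) == (k, l)))%N.
Proof.
rewrite /edge_count.
have -> : zip (mkseq w n.+1) (behead (mkseq w n.+1)) =
    [seq (w i, w i.+1) | i <- iota 0 n].
  apply: (@eq_from_nth _ (k, l)).
    by rewrite size_zip size_behead size_map size_iota size_mkseq /=; lia.
  rewrite size_zip size_behead size_mkseq => i i_lt.
  rewrite nth_zip_cond size_zip size_behead size_mkseq i_lt nth_behead.
  rewrite !nth_mkseq ?(nth_map 0%N) ?nth_iota ?size_iota ?add0n//; lia.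
by rewrite -sumn_count sumnE !big_map -{1}[n]subn0 -/(index_iota 0 n) big_mkord.
Qed.

Lemma sum_edge_count (w : nat -> V) (n : nat) (G : V -> V -> R) :
  (forall i, e (w i) (w i.+1)) ->
  \sum_k \sum_(l | e k l) G k l * (edge_count k l (mkseq w n.+1))%:R =
  \sum_(i < n) G (w i) (w i.+1).
Proof.
move=> ew.
under eq_bigr do under eq_bigr do
  rewrite edge_count_mkseq natr_sum mulr_sumr.
under eq_bigr do rewrite exchange_big.
rewrite exchange_big; apply: eq_bigr => i _ /=.
rewrite (bigD1 (w i))//= (bigD1 (w i.+1)) ?ew//= eqxx mulr1.
rewrite !big1 ?addr0// => [k kw|l /andP[_ lw]].
  by rewrite big1// => l _; rewrite xpair_eqE eq_sym (negPf kw) mulr0.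
by rewrite xpair_eqE eqxx eq_sym (negPf lw) mulr0.
Qed.

(** A closed walk counts a vertex by its outgoing edges, which omits the final position; otherwise
    all n + 1 positions count. *)
Lemma sum_vertex_count (w : nat -> V) (n : nat) (S : {set V}) (v : V -> R) :
  (forall i, e (w i) (w i.+1)) ->
  \sum_(j in S) v j * (vertex_count e j (mkseq w n.+1))%:R =
  \sum_(i < if is_closed (mkseq w n.+1) then n else n.+1)
    (if w i \in S then v (w i) else 0).
Proof.
move=> ew; rewrite /vertex_count; case: ifP => _.
  rewrite -(sum_edge_count _ (fun k _ => if k \in S then v k else 0))//.
  rewrite big_mkcond; apply: eq_bigr => k _; rewrite -mulr_sumr -natr_sum.
  by case: ifP; rewrite ?mul0r.
under eq_bigr do rewrite -sumn_count sumnE !big_map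
    -[in iota 0 _](subn0 n.+1) -/(index_iota 0 n.+1) big_mkord natr_sum mulr_sumr.
rewrite exchange_big; apply: eq_bigr => i _ /=; case: ifPn => wS.
  rewrite (bigD1 (w i))//= eqxx mulr1 big1 ?addr0// => j /andP[_ jw].
  by rewrite eq_sym (negPf jw) mulr0.
apply: big1 => j jS; case: eqP => [wj|]; last by rewrite mulr0.
by rewrite wj jS in wS.
Qed.

(** Makes the cycle itself a truncation of the infinite walk, so that the same sum formulas serve
    both. *)
Lemma mkseq_repeat_walk (x : V) (p : seq V) : is_cycle e (x :: p) ->
  mkseq (repeat_walk x p) (size p).+1 = x :: p.
Proof.
move=> /and4P[_ /eqP lx p0 _]; apply: (@eq_from_nth _ x).
  by rewrite size_mkseq.
rewrite size_mkseq => i; rewrite ltnS => ip; rewrite nth_mkseq// /repeat_walk.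
case: (ltngtP i (size p)) ip => // [ip _|-> _]; first by rewrite modn_small.
by rewrite modnn /= -{1}lx -nth_last; case: (p) p0.
Qed.

Lemma repeat_walk_edge (x : V) (p : seq V) (i : nat) : is_cycle e (x :: p) ->
  e (repeat_walk x p i) (repeat_walk x p i.+1).
Proof.
move=> cyc; have /and4P[/= /(pathP x) xp /eqP lx p0 _] := cyc.
have im : (i %% size p < size p)%N by rewrite ltn_mod.
(* This also holds at the wrap-around, because the last vertex of [p] is [x]. *)
rewrite {1}/repeat_walk; have -> : repeat_walk x p i.+1 = nth x p (i %% size p).
  rewrite /repeat_walk -addn1 -modnDml addn1.
  case: (ltngtP (i %% size p).+1 (size p)) im => // [im _|im _].
    by rewrite modn_small.
  by rewrite im modnn /= -[LHS]lx -nth_last -[in LHS]im.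
exact: xp.
Qed.

End WalkSums.

(** * Contractivity of a cycle and of its repetition *)

Section Contractive.
Variables (V : finType) (e : rel V) (R : realType) (PS PU : {set V}).
Variables (wv : V -> R) (we : V -> V -> R).
Hypothesis wv_gt0 : forall j, 0 < wv j.

(* The weight of a vertex is charged to the edge leaving it, so that a closed walk
   has Xi < rho when its edges have negative total excess. *)
Definition excess (rho : R) (k l : V) : R :=
  we k l + (if k \in PU then wv k else 0) - rho * (if k \in PS then wv k else 0).

Let stable_sum_gt0 (w : nat -> V) (n : nat) : w 0%N \in PS -> (0 < n)%N ->
  0 < \sum_(i < n) (if w i \in PS then wv (w i) else 0).
Proof.
case: n => // n w0 _; rewrite big_ord_recl /= w0 ltr_wpDr//.
by apply: sumr_ge0 => i _; case: ifP => // _; exact: ltW.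
Qed.

Lemma Xi_cycleE (x : V) (p : seq V) : is_cycle e (x :: p) ->
  let w := repeat_walk x p in
  Xi e PS PU wv we (x :: p) =
  (\sum_(i < size p) (we (w i) (w i.+1) + if w i \in PU then wv (w i) else 0))
  / (\sum_(i < size p) if w i \in PS then wv (w i) else 0).
Proof.
move=> cyc w; have ew i : e (w i) (w i.+1) by exact: repeat_walk_edge.
have clo : is_closed (mkseq w (size p).+1).
  by rewrite (mkseq_repeat_walk cyc); case/and4P: cyc.
rewrite -(mkseq_repeat_walk cyc) /Xi sum_edge_count// !sum_vertex_count// clo.
by rewrite big_split.
Qed.

Lemma contractive_cycleP (x : V) (p : seq V) :
  is_cycle e (x :: p) -> x \in PS ->
  let w := repeat_walk x p in
  contractive e PS PU wv we (x :: p) <->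
  \sum_(i < size p) excess 1 (w i) (w i.+1) < 0.
Proof.
move=> cyc xS w; rewrite /contractive Xi_cycleE//.
have p0 : (0 < size p)%N by case/and4P: cyc.
have w0 : w 0%N \in PS by rewrite /w /repeat_walk mod0n.
rewrite ltr_pdivrMr ?stable_sum_gt0// mul1r -subr_lt0 -sumrB.
by under [in X in _ <-> X]eq_bigr do rewrite /excess mul1r.
Qed.

(** With n = q * m + r, the sum is q * D plus a partial period, which stays bounded while q * D
    tends to -oo. *)
Lemma periodic_sum_ltN (z : nat -> R) (m : nat) (K : R) :
  (forall i, z (i + m)%N = z i) -> \sum_(i < m) z i < 0 ->
  exists N, forall n, (N <= n)%N -> \sum_(i < n) z i <= - K.
Proof.
move=> zm; set D := \sum_(i < m) z i => D0.
have m0 : (0 < m)%N 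
  by rewrite lt0n; apply/eqP => m0; move: D0; rewrite /D m0 big_ord0 ltxx.
pose s n := \sum_(i < n) z i.
have sD n : s (n + m)%N = s n + D.
  rewrite /s addnC big_split_ord /= addrC; congr (_ + _).
  by apply: eq_bigr => i _; rewrite addnC zm.
have sq q r : s (q * m + r)%N = D * q%:R + s r.
  elim: q => [|q IH]; first by rewrite mulr0 add0r.
  by rewrite mulSn -addnA addnC sD IH -natr1; ring.
pose M := \sum_(i < m) `|z i|.
have sM r : (r < m)%N -> s r <= M.
  move=> rm; apply: (@le_trans _ _ (\sum_(i < r) `|z i|)).
    by apply: ler_sum => i _; exact: ler_norm.
  rewrite /M -(subnKC (ltnW rm)) big_split_ord /= lerDl.
  by apply: sumr_ge0.
(* Enough full periods for q * (- D) >= M + K, where [M] bounds the partial period. *)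
exists (Num.bound `|(M + K) / - D| * m)%N => n Nn.
rewrite [n in X in X <= _](divn_eq n m) -/(s _) sq.
have qn : (Num.bound `|(M + K) / - D| <= n %/ m)%N by rewrite leq_divRL.
have : (M + K) / - D <= (n %/ m)%:R.
  apply: le_trans (ler_norm _) _; apply: le_trans (ltW (archi_boundP _)) _ => //.
  by rewrite ler_nat.
rewrite ler_pdivrMr ?oppr_gt0// => MK.
by have := sM _ (ltn_pmod n m0); lra.
Qed.

(* For rho < 1 above the value of Xi on the cycle, the excess over one period is
   still negative, so its partial sums tend to -oo and absorb the weight of the
   last vertex, which counts only when the initial subwalk is not closed. *)
Lemma limn_esup_Xi_lt1 (x : V) (p : seq V) :
  is_cycle e (x :: p) -> x \in PS -> contractive e PS PU wv we (x :: p) ->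
  (limn_esup (fun n =>
     (Xi e PS PU wv we (initial_subwalk (repeat_walk x p) n))%:E) < 1%:E)%E.
Proof.
move=> cyc xS; rewrite /contractive Xi_cycleE//.
set w := repeat_walk x p; set Num := \sum_(i < _) (_ + _).
set Den := \sum_(i < _) _ => ND.
have p0 : (0 < size p)%N by case/and4P: cyc.
have w0 : w 0%N \in PS by rewrite /w /repeat_walk mod0n.
have Den0 : 0 < Den by exact: stable_sum_gt0.
have {ND} ND : Num < Den by move: ND; rewrite ltr_pdivrMr// mul1r.
have [rho [rho0 rho1 ND']] : exists rho, [/\ 0 <= rho, rho < 1 & Num < rho * Den].
  (* The midpoint of Num / Den and 1, raised to 0 if negative so that [rho] times a weight is
     nonnegative. *)
  exists (Num.max 0 ((Num + Den) / (2 * Den))); split.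
  - by rewrite le_max lexx.
  - by rewrite gt_max ltr01 ltr_pdivrMr ?mulr_gt0// mul1r; lra.
  apply: (@lt_le_trans _ _ ((Num + Den) / (2 * Den) * Den)).
    have -> : (Num + Den) / (2 * Den) * Den = (Num + Den) / 2.
      by field; exact: lt0r_neq0.
    lra.
  by rewrite ler_wpM2r ?(ltW Den0)// le_max lexx orbT.
pose z i := excess rho (w i) (w i.+1).
have zm i : z (i + size p)%N = z i.
  by rewrite /z /w /repeat_walk -addSn !modnDr.
have zlt0 : \sum_(i < size p) z i < 0.
  by rewrite /z /excess sumrB -mulr_sumr subr_lt0.
pose K := \sum_j wv j.
have wvK j : wv j <= K.
  by rewrite /K (bigD1 j)//= lerDl sumr_ge0// => i _; exact: ltW.
have [N zN] := periodic_sum_ltN K zm zlt0.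
apply: (@le_lt_trans _ _ rho%:E); last by rewrite lte_fin.
(* The upper limit is at most the supremum over any tail. The tail starts at 1 or later because the
   walk of length 0 is closed and has denominator 0. *)
apply: (@le_trans _ _ (ereal_sup [set (Xi e PS PU wv we (initial_subwalk w n))%:E
    | n in [set n | (maxn 1 N <= n)%N]])).
  apply: ereal_inf_lbound => /=.
  by exists [set n | (maxn 1 N <= n)%N] => //; exists (maxn 1 N).
apply: ge_ereal_sup => _ [n /= + <-]; rewrite geq_max => /andP[n0 Nn].
have ew i : e (w i) (w i.+1) by exact: repeat_walk_edge.
rewrite lee_fin /initial_subwalk /Xi sum_edge_count// !sum_vertex_count//.
set n' := if _ then _ else _.
have n'0 : (0 < n')%N by rewrite /n'; case: ifP.
rewrite ler_pdivrMr ?stable_sum_gt0// -subr_le0.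
apply: (@le_trans _ _ (\sum_(i < n) z i + K)); last by have := zN n Nn; lra.
rewrite /z /excess sumrB big_split -mulr_sumr /=.
rewrite /n'; case: ifP => _.
  by rewrite lerDl; apply: le_trans (wvK x); exact: ltW.
rewrite !big_ord_recr /=.
set u := if _ then _ else _; set v := if w n \in PS then _ else _.
have uK : u <= K.
  by rewrite /u; case: ifP => // _; apply: le_trans (wvK x); exact: ltW.
have v0 : 0 <= rho * v by rewrite mulr_ge0// /v; case: ifP => // _; exact: ltW.
by rewrite mulrDr; lra.
Qed.

End Contractive.

(** The head is found as a member of [stable_out]. This serves the upper limit claim, which concerns
    every outcome and not only runs of positive probability. *)
Lemma detected_cycle_head (V : finType) (e : rel V) (PS : {set V})
    (s : seq V) (x : V) (p : seq V) :
  detected_cycle e PS s = x :: p -> x \in PS.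
Proof.
case: s => [//|j s]; rewrite /detected_cycle.
set a := mem _; have [ha|hna] := boolP (has a (j :: s)); last first.
  by rewrite hasNfind// drop_size.
rewrite (drop_nth j) -?has_find// => -[<- _].
by have := nth_find j ha; rewrite /a /= inE => /andP[].
Qed.

(** * Sigma-algebras generated by random variables *)

Section SigmaRV.
Context d (T : measurableType d) (R : realType).

(** Gives access to the closure of measurable functions under sums and products. *)
Lemma sigma_rvP (Xs : set (T -> R)) (f : T -> R) :
  (forall B, measurable B -> sigma_rv Xs (f @^-1` B)) <->
  measurable_fun setT (f : g_sigma_algebraType
    [set X @^-1` B | X in Xs & B in [set B : set R | measurable B]] -> R).
Proof.
split=> [mf _ B mB|mf B mB]; first by rewrite setTI; exact: mf.
by have := mf measurableT B mB; rewrite setTI.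
Qed.

Lemma sigma_rv_mem (Xs : set (T -> R)) (X : T -> R) (B : set R) :
  Xs X -> measurable B -> sigma_rv Xs (X @^-1` B).
Proof. by move=> XX mB; apply: sub_gen_smallest; exists X => //; exists B. Qed.

Lemma sigma_rv_measurable (Xs : set (T -> R)) (E : set T) :
  (forall X, Xs X -> measurable_fun setT X) -> sigma_rv Xs E -> measurable E.
Proof.
move=> mXs; apply: smallest_sub; first exact: sigma_algebra_measurable.
by move=> _ [X XX [B mB <-]]; rewrite -[_ @^-1` _]setTI; exact: mXs.
Qed.

End SigmaRV.

(** Puts the terms of one period in distinct independence classes, which are indexed by source
    vertices. *)
Lemma cycle_uniq_vertices (V : finType) (e : rel V) (x : V) (p : seq V) :
  is_cycle e (x :: p) -> uniq (map (repeat_walk x p) (iota 0 (size p))).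
Proof.
move=> cyc; have /and4P[_ /eqP lx p0 up] := cyc.
have := mkseq_repeat_walk cyc; rewrite /mkseq -addn1 iotaD map_cat.
case/lastP: p lx p0 up {cyc} => // p y; rewrite last_rcons /= => -> _.
rewrite rcons_uniq -rcons_cons cats1 => up /rcons_inj[-> _].
exact: up.
Qed.

(** * The tail bound for a fixed cycle *)

Section CycleProbability.
Context d (T : measurableType d) (R : realType) (P : probability T R).
Variables (V : finType) (e : rel V) (PS PU : {set V}).
Hypothesis hpart : PU = (~: PS)%SET.
Variables (wv : V -> {RV P >-> R}) (we : V -> V -> {RV P >-> R}).
Variables (alpha beta A B : R).
Hypotheses (hweight : nicely_weighted e wv we alpha beta A B)
  (hindep : independent_sources e wv we).

Let wv_gt0 j t : 0 < wv j t.
Proof. by case: hweight => _ _ /(_ j)[/(_ t)/andP[]]. Qed.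

Lemma not_contractiveE (x : V) (p : seq V) : is_cycle e (x :: p) -> x \in PS ->
  let w := repeat_walk x p in
  [set t | ~ contractive e PS PU (fun j => wv j t) (fun k l => we k l t) (x :: p)]
  = [set t | 0 <= \sum_(i < size p)
       excess PS PU (fun j => wv j t) (fun k l => we k l t) 1 (w i) (w i.+1)].
Proof.
move=> cyc xS w; apply/seteqP; split => t /=;
  have [c1 c2] := @contractive_cycleP _ e R PS PU (fun j => wv j t)
    (fun k l => we k l t) (fun j => wv_gt0 j t) x p cyc xS.
  by move=> nc; rewrite leNgt; apply/negP => /c2.
by move=> ge0 /c1; rewrite ltNge ge0.
Qed.

(** The form in which the independence of the run from the weights applies to this event. *)
Lemma not_contractive_sigma (x : V) (p : seq V) :
  is_cycle e (x :: p) -> x \in PS ->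
  sigma_rv (\bigcup_j out_weights e wv we j)
    [set t | ~ contractive e PS PU (fun j => wv j t) (fun k l => we k l t) (x :: p)].
Proof.
move=> cyc xS; rewrite not_contractiveE//.
set w := repeat_walk x p; set U := \bigcup_j _.
pose S t := \sum_(i < size p)
  excess PS PU (fun j => wv j t) (fun k l => we k l t) 1 (w i) (w i.+1).
have -> : [set t | 0 <= S t] = S @^-1` `[0, +oo[.
  by apply/seteqP; split => t /=; rewrite in_itv /= andbT.
apply: (sigma_rvP U S).2; last exact: measurable_itv.
apply: measurable_sum => i; rewrite /excess.
have mwv : measurable_fun setT (wv (w i) : g_sigma_algebraType
    [set X @^-1` B | X in U & B in [set B : set R | measurable B]] -> R).
  apply/sigma_rvP => C mC; apply: sigma_rv_mem => //.
  by exists (w i) => //; left.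
apply: measurable_funB.
  apply: measurable_funD; last by case: (w i \in PU).
  apply/sigma_rvP => C mC; apply: sigma_rv_mem => //.
  by exists (w i) => //; right; exists (w i.+1) => //; exact: repeat_walk_edge.
by apply: measurable_funM => //; case: (w i \in PS).
Qed.

Lemma out_weights_measurable (j : V) (X : T -> R) :
  out_weights e wv we j X -> measurable_fun setT X.
Proof. by case=> [->|[l _ ->]]; exact: measurable_funP. Qed.

Lemma measurable_not_contractive (x : V) (p : seq V) :
  is_cycle e (x :: p) -> x \in PS -> measurable
    [set t | ~ contractive e PS PU (fun j => wv j t) (fun k l => we k l t) (x :: p)].
Proof.
move=> cyc xS; apply: sigma_rv_measurable (not_contractive_sigma cyc xS).
by move=> X [j _]; exact: out_weights_measurable.
Qed.

(** All vertices being stable, the excess at step i is an edge weight minus a vertex weight, both in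
    [out_weights] of the source. *)
Lemma prob_not_contractive_le (x : V) (p : seq V) :
  is_cycle e (x :: p) -> all (mem PS) (x :: p) ->
  (P [set t | ~ contractive e PS PU (fun j => wv j t) (fun k l => we k l t) (x :: p)]
   <= (expR (- (2^-1 * ((alpha - beta) / (A + B)) ^+ 2 * (size p)%:R)))%:E)%E.
Proof.
move=> cyc pS; have xS : x \in PS by case/andP: pS.
case: hweight => /andP[beta0 betaB] _ hv [A0 ab] he.
rewrite not_contractiveE//; set w := repeat_walk x p.
have ew i : e (w i) (w i.+1) by exact: repeat_walk_edge.
have wS i : w i \in PS.
  have : w i \in x :: p.
    apply: mem_nth; rewrite /= ltnS ltnW// ltn_mod.
    by case/and4P: cyc.
  by move=> wp; exact: (allP pS).
pose X (i : 'I_(size p)) t := we (w i) (w i.+1) t - wv (w i) t.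
have -> : [set t | 0 <= \sum_(i < size p)
    excess PS PU (fun j => wv j t) (fun k l => we k l t) 1 (w i) (w i.+1)] =
  [set t | 0 <= \sum_(i <- enum 'I_(size p)) X i t].
  apply/funext => t /=; rewrite big_enum /=; congr (is_true (0 <= _)).
  apply: eq_big => // i _.
  by rewrite /excess hpart finset.in_setC wS /= addr0 mul1r.
have -> : ((alpha - beta) / (A + B)) ^+ 2 = ((beta - alpha) / (A + B)) ^+ 2.
  by rewrite -sqrrN -mulNr opprB.
have -> : (size p)%:R = (size (enum 'I_(size p)))%:R :> R by rewrite size_enum_ord.
have Xc i t : `|X i t| <= A + B.
  have [/(_ t)/andP[v0 vB] _] := hv (w i).
  have [/(_ t)/andP[e1 e2] _] := he _ _ (ew i).
  by rewrite ler_norml /X; lra.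
apply: (@prob_sum_ge0_le _ _ _ P V
    (fun j => sigma_rv (out_weights e wv we j)) _ (fun i : 'I_(size p) => w i) X
    (fun i => fine ('E_P[we (w i) (w i.+1)]) - beta) (A + B)) => //.
- move=> j E; apply: sigma_rv_measurable; exact: out_weights_measurable.
- lra.
- lra.
- move=> i; apply/sigma_rvP; apply: measurable_funB; apply/sigma_rvP => C mC.
    by apply: sigma_rv_mem => //; right; exists (w i.+1).
  by apply: sigma_rv_mem => //; left.
- move=> i.
  have ie : P.-integrable setT (EFin \o we (w i) (w i.+1)).
    apply: (@integrable_bounded _ _ _ P _ A) => [|t]; first exact: measurable_funP.
    by have [/(_ t)] := he _ _ (ew i); rewrite ler_norml.
  have iv : P.-integrable setT (EFin \o wv (w i)).
    apply: (@integrable_bounded _ _ _ P _ B) => [|t]; first exact: measurable_funP.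
    have [/(_ t)/andP[v0 vB] _] := hv (w i).
    by rewrite ler_norml vB andbT; lra.
  rewrite /X; under eq_integral do rewrite EFinB.
  rewrite integralB_EFin// -!expectation_def (hv _).2 EFinB fineK//.
  rewrite expectation_def; exact: integrable_fin_num.
- move=> i; have [bd Ele] := he _ _ (ew i).
  rewrite opprB lerD2r -lee_fin fineK//.
  apply: expectation_fin_num; apply/Lfun1_integrable.
  apply: (@integrable_bounded _ _ _ P _ A) => [|t]; first exact: measurable_funP.
  by rewrite ler_norml.
- rewrite (map_comp (w : nat -> V) (@nat_of_ord _)) val_enum_ord.
  exact: cycle_uniq_vertices cyc.
Qed.

End CycleProbability.

(** * Total probability over a countably valued map *)

Section DiscreteTotalProbability.
Context d (T : measurableType d) (R : realType) (P : probability T R).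
Variables (K : countType) (J : T -> K).
Hypothesis mJ : forall s, measurable (J @^-1` [set s]).

Let fiber n := [set t | pickle (J t) = n].

Let fiberE n : fiber n = set0 \/ exists s, fiber n = J @^-1` [set s].
Proof.
have [[s sn]|no] := pselect (exists s : K, pickle s = n); last first.
  by left; rewrite -subset0 => t /= Jt; apply: no; exists (J t).
right; exists s; rewrite /fiber -sn; apply/seteqP; split => t /= [Jts].
  exact: (pcan_inj (@pickleK K)).
by rewrite Jts.
Qed.

Let bigcup_fiber (E : set T) : E = \bigcup_n (E `&` fiber n).
Proof.
rewrite -setI_bigcupr; apply/seteqP; split => [t Et|t []//].
by split => //; exists (pickle (J t)).
Qed.

Lemma measurable_fibers (E : set T) :
  (forall s, measurable (J @^-1` [set s] `&` E)) -> measurable E.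
Proof.
move=> mE; rewrite (bigcup_fiber E); apply: bigcupT_measurable => n.
have [->|[s ->]] := fiberE n; first by rewrite setI0.
by rewrite setIC.
Qed.

Lemma prob_le_fibers (E : set T) (q : R) : 0 <= q -> measurable E ->
  (forall s, P (J @^-1` [set s] `&` E) <= q%:E * P (J @^-1` [set s]))%E ->
  (P E <= q%:E)%E.
Proof.
move=> q0 mE hE.
have mfiber n : measurable (fiber n) by have [->|[s ->]] := fiberE n.
have tfiber : trivIset setT fiber.
  apply/trivIsetP => i j _ _ ij; rewrite -subset0 => t [it jt].
  by move/eqP: ij; apply; rewrite -it -jt.
rewrite {1}(bigcup_fiber E) measure_bigcup//=; last 2 first.
- by move=> n _; exact: measurableI.
- exact: trivIset_setIl.
(* The fibres cover the space, so both sides become series to be compared termwise. *)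
have -> : q%:E = (q%:E * P (\bigcup_n fiber n))%E.
  rewrite -[X in (_ * P X)%E]setTI setI_bigcupr -bigcup_fiber.
  by rewrite -[LHS]mule1; congr (_ * _)%E; rewrite probability_setT.
rewrite measure_bigcup//= -nneseriesZl//.
apply: lee_nneseries => // n _.
have [->|[s ->]] := fiberE n; first by rewrite setI0 measure0 mule0.
by rewrite setIC hE.
Qed.

End DiscreteTotalProbability.

(** * Conditioning on the run of the algorithm *)

Theorem theorem21 (R : realType) (d : measure_display) (T : measurableType d)
    (P : probability T R)
    (N : nat) (e : rel 'I_N) (PS PU : {set 'I_N})
    (hpart : PU = (~: PS)%SET)
    (wv : 'I_N -> {RV P >-> R}) (we : 'I_N -> 'I_N -> {RV P >-> R})
    (Phi : nat -> R) (hPhi : {homo Phi : m n / (m <= n)%N >-> m <= n})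
    (alpha beta A B : R)
    (hconn : nicely_connected e PS Phi)
    (hweight : nicely_weighted e wv we alpha beta A B)
    (hindep : independent_sources e wv we)
    (J : T -> seq 'I_N) (hJ : algorithm_run e wv we PS J) :
  let L : int := Num.floor (Phi #|PS|) in
  let C (t : T) : seq 'I_N := detected_cycle e PS (J t) in
  let good (t : T) : Prop :=
    [/\ is_cycle e (C t), L <= (walk_length (C t))%:Z &
        contractive e PS PU (fun j => wv j t) (fun k l => we k l t) (C t)] in
  ((1 - expR (- (2^-1 * ((alpha - beta) / (A + B)) ^+ 2 * L%:~R)))%:E
     <= P [set t | good t])%E
  /\
  (forall (t : T) (x : 'I_N) (p : seq 'I_N), good t -> C t = x :: p ->
     (limn_esup (fun n =>
        (Xi e PS PU (fun j => wv j t) (fun k l => we k l t)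
           (initial_subwalk (repeat_walk x p) n))%:E) < 1%:E)%E).
Proof.
move=> L C good.
have wv_gt0 j t : 0 < wv j t.
  by case: hweight => _ _ /(_ j)[/(_ t)/andP[]].
split; last first.
  move=> t x p [cyc _ con] Ct; move: cyc con; rewrite Ct => cyc con.
  exact: (limn_esup_Xi_lt1 (fun j => wv_gt0 j t) cyc (detected_cycle_head Ct) con).
set q := expR _.
have q0 : 0 <= q by exact: expR_ge0.
have [mJ PJ indJ] := hJ.
pose bad s := [set t | ~ contractive e PS PU (fun j => wv j t)
  (fun k l => we k l t) (detected_cycle e PS s)].
have mbad s : is_cycle e (detected_cycle e PS s) -> measurable (bad s).
  rewrite /bad; case E : (detected_cycle e PS s) => [//|x p] cyc.
  exact: (measurable_not_contractive PU hweight cyc (detected_cycle_head E)).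
have mgood : measurable [set t | good t].
  (* On a fibre of [J] the cycle is fixed, so only contractivity depends on the outcome. *)
  apply: (@measurable_fibers _ _ _ J) => s.
  have [cyc|ncyc] := boolP (is_cycle e (detected_cycle e PS s)); last first.
    rewrite (_ : _ `&` _ = set0)//; rewrite -subset0 => t [/= Jt [cyc _ _]].
    by move: cyc; rewrite /C Jt (negPf ncyc).
  have [len|nlen] := boolP (L <= (walk_length (detected_cycle e PS s))%:Z); last first.
    rewrite (_ : _ `&` _ = set0)//; rewrite -subset0 => t [/= Jt [_ len _]].
    by move: len; rewrite /C Jt (negPf nlen).
  rewrite (_ : _ `&` _ = J @^-1` [set s] `&` ~` bad s).
    by apply: measurableI => //; apply: measurableC; exact: mbad.
  apply/seteqP; split => t [/= Jt]; rewrite /good /C Jt.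
    by case=> _ _ con; split.
  by move=> /contrapT con; split.
rewrite -[[set t | good t]]setCK probability_setC; last exact: measurableC.
rewrite EFinB leeB//.
(* If L <= 0 then q >= 1 and the bound is trivial; a run may then detect no cycle. *)
have [L0|L0] := leP L 0.
  apply: (@le_trans _ _ 1%E); first exact: probability_le1 (measurableC mgood).
  rewrite lee_fin -[leLHS]expR0 ler_expR oppr_ge0 mulr_ge0_le0//.
    by rewrite mulr_ge0// sqr_ge0.
  by rewrite lerz0.
apply: (prob_le_fibers mJ q0); first exact: measurableC.
move=> s.
have [rs0|rs0] := eqVneq (run_prob e PS R s) 0.
  have J0 : P (J @^-1` [set s]) = 0%E by rewrite PJ rs0.
  rewrite J0 mule0 -J0; apply: le_measure; rewrite ?inE//.
  by apply: measurableI => //; exact: measurableC.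
case: s rs0 => [|j s] rs0; first by rewrite eqxx in rs0.
have Lj i : L <= (#|stable_out e PS i|)%:Z by exact: hconn.
have [|cyc CS len] := detected_cycle_run rs0.
  by rewrite -finset.card_gt0; have := lt_le_trans L0 (Lj (last j s)).
have {}len : L <= (walk_length (detected_cycle e PS (j :: s)))%:Z.
  by apply: le_trans (Lj (last j s)) _; rewrite lez_nat.
(* On a possible run, the cycle and length conditions hold, so failure means only that the cycle is
   not contractive. *)
have -> : J @^-1` [set j :: s] `&` ~` [set t | good t] =
    J @^-1` [set j :: s] `&` bad (j :: s).
  apply/seteqP; split => t [/= Jt]; rewrite /good /bad /C /= Jt.
    by move=> ng; split=> // con; apply: ng.
  by move=> ncon; split=> // -[].
case E : (detected_cycle e PS (j :: s)) cyc CS len => [//|x p] cyc CS len.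
have sbad : sigma_rv (\bigcup_j out_weights e wv we j) (bad (j :: s)).
  rewrite /bad E.
  exact: (not_contractive_sigma PU hweight cyc (detected_cycle_head E)).
rewrite indJ// muleC; apply: lee_wpmul2r; first exact: measure_ge0.
rewrite /bad E.
apply: le_trans (prob_not_contractive_le hpart hweight hindep cyc CS) _.
(* The exponent has the cycle length, at least [L], in place of [L]. *)
rewrite lee_fin ler_expR lerN2 ler_wpM2l//.
  by rewrite mulr_ge0// sqr_ge0.
by rewrite -[(size p)%:R]/((size p)%:Z%:~R) ler_int.
Qed.
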